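(* Let $H$ be a regular hypersemigroup and let $B$ be a nonempty subset of $H$. Then $B$ is a bi-ideal of $H$ if and only if there exist a right ideal $C$ of $H$ and a left ideal $D$ of $H$ such that $B = C*D$.
   Context: For a set $H$, let $\mathcal{P}^*(H)$ denote the set of nonempty subsets of $H$. A hypergroupoid is a nonempty set $H$ with a hyperoperation $\circ : H\times H \to \mathcal{P}^*(H)$, $(a,b)\mapsto a\circ b$, together with the induced operation $*$ on $\mathcal{P}^*(H)$ given by $A*B=\bigcup_{(a,b)\in A\times B}(a\circ b)$ for $A,B\in\mathcal{P}^*(H)$. A hypersemigroup is a hypergroupoid $H$ such that $\{x\}*(y\circ z)=(x\circ y)*\{z\}$ for all $x,y,z\in H$. In a hypersemigroup the operation $*$ on $\mathcal{P}^*(H)$ is associative, so one writes $A*B*C$ for $(A*B)*C=A*(B*C)$. A nonempty subset $A$ of $H$ is a left ideal of $H$ if $H*A\subseteq A$, and a right ideal of $H$ if $A*H\subseteq A$. A hypersemigroup $H$ is regular if $A\subseteq A*H*A$ for every $A\in\mathcal{P}^*(H)$. A nonempty subset $B$ of a hypersemigroup $H$ is a bi-ideal of $H$ if $B*H*B\subseteq B$. *)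

(* Defs.v *)
From mathcomp Require Import all_boot.
From mathcomp Require Import classical_sets.

Set Implicit Arguments.
Unset Strict Implicit.
Unset Printing Implicit Defensive.

Local Open Scope classical_set_scope.

Declare Scope hyper_scope.
Delimit Scope hyper_scope with hyper.

(* Subsets of H are the predicates [set H]; the set P*(H) of nonempty subsets
   is rendered by nonemptiness side conditions [_ !=set0]. *)
Record hypergroupoid := Hypergroupoid {
  hcarrier :> Type;
  hcarrier_neq0 : [set: hcarrier] !=set0;
  hop : hcarrier -> hcarrier -> set hcarrier;
  hop_neq0 : forall a b, hop a b !=set0 }.

Definition hmul (H : hypergroupoid) (A B : set H) : set H :=
  \bigcup_(ab in A `*` B) hop ab.1 ab.2.

Notation "a \o' b" := (hop a b)
  (at level 40, left associativity) : hyper_scope.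
Notation "A ** B" := (hmul A B)
  (at level 40, left associativity) : hyper_scope.

Local Open Scope hyper_scope.

(* [hmul] restricts to an operation on P*(H). *)
Lemma hmul_neq0 (H : hypergroupoid) (A B : set H) :
  A !=set0 -> B !=set0 -> A ** B !=set0.
Proof.
move=> [a Aa] [b Bb]; have [c abc] := hop_neq0 a b.
by exists c, (a, b).
Qed.

Record hypersemigroup := Hypersemigroup {
  hgroupoid :> hypergroupoid;
  hop_assoc : forall x y z : hgroupoid,
    [set x] ** (y \o' z) = (x \o' y) ** [set z] }.

Lemma hmulA (H : hypersemigroup) (A B C : set H) :
  A ** (B ** C) = (A ** B) ** C.
Proof.
apply/seteqP; split=> t.
- case=> -[x u] /= [Ax [[y z] /= [By Cz] yzu]] xut.
  have: ([set x] ** (y \o' z)) t by exists (x, u).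
  rewrite hop_assoc => -[[v z'] /= [xyv ->] vzt].
  by exists (v, z) => //; split=> //; exists (x, y).
- case=> -[v z] /= [[[x y] /= [Ax By] xyv] Cz] vzt.
  have: ((x \o' y) ** [set z]) t by exists (v, z).
  rewrite -hop_assoc => -[[x' u] /= [-> yzu] xut].
  by exists (x, u) => //; split=> //; exists (y, z).
Qed.

Definition left_ideal (H : hypergroupoid) (A : set H) : Prop :=
  A !=set0 /\ [set: H] ** A `<=` A.

Definition right_ideal (H : hypergroupoid) (A : set H) : Prop :=
  A !=set0 /\ A ** [set: H] `<=` A.

Definition regular (H : hypersemigroup) : Prop :=
  forall A : set H, A !=set0 -> A `<=` A ** [set: H] ** A.

Definition bi_ideal (H : hypersemigroup) (B : set H) : Prop :=
  B !=set0 /\ B ** [set: H] ** B `<=` B.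

(* Main.v *)
Require Import Defs.
From mathcomp Require Import all_boot.
From mathcomp Require Import classical_sets.

(** A bi-ideal [B] is recovered from the one-sided ideals it generates:
    [C = B ** H] is a right ideal and [D = H ** B] is a left ideal.  Their
    product [B ** H ** H ** B] lies in [B ** H ** B], hence in [B].
    Conversely, applying regularity twice gives
    [B `<=` B ** H ** B `<=` (B ** H ** B) ** H ** B], and absorbing the
    middle [B] into a factor [H] turns the last product into one contained in
    [C ** D].

    In the other direction, [C ** D ** H ** C ** D] is contained in
    [C ** H ** D], and so in [C ** D], because the right ideal [C] absorbs
    whatever stands to its right.  Everything is thus a computation with an
    associative product that is monotone in both arguments. *)

Local Open Scope classical_set_scope.
Local Open Scope hyper_scope.

Lemma hmul_subset (H : hypergroupoid) (A A' B B' : set H) :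
  A `<=` A' -> B `<=` B' -> A ** B `<=` A' ** B'.
Proof.
move=> sA sB x [[a b] /= [Aa Bb] abx].
by exists (a, b) => //; split; [apply: sA | apply: sB].
Qed.

Lemma right_ideal_hmulT (H : hypersemigroup) (B : set H) :
  B !=set0 -> right_ideal (B ** [set: H]).
Proof.
move=> B0; split; first exact: hmul_neq0 B0 (hcarrier_neq0 H).
by rewrite -hmulA; apply: hmul_subset.
Qed.

Lemma left_ideal_hmulT (H : hypersemigroup) (B : set H) :
  B !=set0 -> left_ideal ([set: H] ** B).
Proof.
move=> B0; split; first exact: hmul_neq0 (hcarrier_neq0 H) B0.
by rewrite hmulA; apply: hmul_subset.
Qed.

(** In [C ** D ** H ** C ** D] the leading [C] absorbs the inner factors
    [D ** H ** C], and the final [D] remains. *)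
Lemma bi_ideal_hmul (H : hypersemigroup) (C D : set H) :
  right_ideal C -> D !=set0 -> bi_ideal (C ** D).
Proof.
move=> [C0 CT] D0; split; first exact: hmul_neq0 C0 D0.
rewrite hmulA; apply: hmul_subset => //.
by apply: subset_trans CT; rewrite -!hmulA; apply: hmul_subset.
Qed.

Lemma regular_bi_idealE (H : hypersemigroup) (B : set H) :
  regular H -> bi_ideal B -> B = (B ** [set: H]) ** ([set: H] ** B).
Proof.
move=> regH [B0 BTB]; apply/seteqP; split.
- have sB := regH B B0.
  have sBB : B `<=` (B ** [set: H] ** B) ** [set: H] ** B.
    apply: (subset_trans sB); apply: hmul_subset => //.
    exact: hmul_subset.
  apply: subset_trans sBB _.
  (* Regrouped as (B H) ((B H) B), so that the second B H grows to H. *)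
  rewrite -(hmulA (B ** [set: H])) -(hmulA (B ** [set: H])).
  by apply: hmul_subset => //; apply: hmul_subset.
- apply: subset_trans BTB.
  by rewrite hmulA; apply: hmul_subset => //; rewrite -hmulA; apply: hmul_subset.
Qed.

Theorem theorem9 (H : hypersemigroup) (hH : regular H)
    (B : set H) (hB : B !=set0) :
  bi_ideal B <->
  exists C D : set H, right_ideal C /\ left_ideal D /\ B = C ** D.
Proof.
split=> [biB | [C [D [rC [[D0 _] ->]]]]]; last exact: bi_ideal_hmul.
exists (B ** [set: H]), ([set: H] ** B).
split; first exact: right_ideal_hmulT.
by split; [exact: left_ideal_hmulT | exact: regular_bi_idealE].
Qed.
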